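(* In the setting described in the context, suppose there exists a set $S\subset V$ with $\mathrm{vol}(S)=\delta$ and $\Phi(S)\le\gamma$. Then there exists $F':\mathcal V'\to\{0,1\}$ such that \[ \mathrm{Var}_1[F']=\mathbb E_{X,Y\sim\mu'}|F'(X)-F'(Y)|\ge\frac1{10} \] and \[ \mathrm{val}_{\mathcal P'}(F')=\mathbb E_{(X,Y_1,\dots,Y_d)\sim\mathcal P'}\Big[\max_i|F'(X)-F'(Y_i)|\Big]\le 2\epsilon+O(d(\eta+\gamma))\le4\epsilon. \]
   Context: Let $G=(V,E)$ be a finite regular graph of degree $k$, $\mu_V$ uniform on $V$, $\mathrm{vol}(S)=|S|/|V|$ and $\Phi(S)=|E(S,V\setminus S)|/(k|S|)$. Parameters: $\epsilon\in(0,1/3]$, an integer $d\ge1$, $\delta>0$ with $R=1/\delta$ a positive integer, $\eta=\epsilon/(100d)$ and $0<\gamma<\epsilon/(100d)$. A step of $G_\eta=(1-\eta)G+\eta K_V$ from $a\in V$: with probability $1-\eta$ move to a uniformly random $G$-neighbour of $a$, with probability $\eta$ to a uniformly random vertex of $V$. For $A=(a_1,\dots,a_R)\in V^R$, $B\sim G_\eta^{\otimes R}(A)$ means $b_i\sim G_\eta(a_i)$ independently. $H$ is the Markov chain on $V_H=\{s,t,t',s'\}$ with $p(s|s)=p(s'|s')=1-\frac{\epsilon}{1-2\epsilon}$, $p(t|s)=p(t'|s')=\frac{\epsilon}{1-2\epsilon}$, $p(s|t)=p(s'|t')=p(t'|t)=p(t|t')=\frac12$, with stationary distribution $\mu_H(s)=\mu_H(s')=\frac12-\epsilon$,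 $\mu_H(t)=\mu_H(t')=\epsilon$; $y\sim H^R(x)$ denotes one step of the product chain from $x\in V_H^R$ (coordinates move independently). Unfolded instance: $\mathcal V=(V\times V_H)^R$ with $\mu=(\mu_V\times\mu_H)^{\otimes R}$, and $\mathcal P$ on $\mathcal V^{d+1}$ sampled by: $A$ uniform in $V^R$; $B,C_1,\dots,C_d$ independent $\sim G_\eta^{\otimes R}(A)$; $x\sim\mu_H^{\otimes R}$; $y_1,\dots,y_d$ independent $\sim H^R(x)$; output $((B,x),(C_1,y_1),\dots,(C_d,y_d))$. Projection $\Pi((a_1,x_1),\dots,(a_R,x_R))=$ the multiset $\{(a_i,x_i):x_i\in\{s,t\}\}$. Folded instance: $\mathcal V'$ = set of multisets of elements of $V\times\{s,t\}$ with at most $R$ elements; $\mu'$ is the pushforward of $\mu$ under $\Pi$, and $\mathcal P'$ the pushforward of $\mathcal P$ under $\Pi$ applied to each of the $d+1$ coordinates. In $\mathbb E_{X,Y\sim\mu'}$, $X,Y$ are independent. $O(\cdot)$ hides an absolute constant. *)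

(* Defs.v *)
From HB Require Import structures.
From mathcomp Require Import all_boot all_order all_algebra.
From mathcomp Require Import reals.

Set Implicit Arguments.
Unset Strict Implicit.
Unset Printing Implicit Defensive.

Import Order.TTheory GRing.Theory Num.Theory.
Local Open Scope ring_scope.

(* Distributions on a finite type are given by their mass functions. *)
Section FiniteDistributions.
Variables (K : realType) (T U : finType).

Definition expectation (P : T -> K) (f : T -> K) : K := \sum_x P x * f x.

Definition pushforward (f : T -> U) (P : T -> K) : U -> K :=
  fun y => \sum_(x | f x == y) P x.

(* Independent product of n copies of a distribution, and of a transition
   kernel, where [M x y] is the probability of moving from x to y. *)
Definition tensor_dist (n : nat) (P : T -> K) (x : {ffun 'I_n -> T}) : K :=
  \prod_(i < n) P (x i).

Definition tensor_kernel (n : nat) (M : T -> U -> K)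
    (x : {ffun 'I_n -> T}) (y : {ffun 'I_n -> U}) : K :=
  \prod_(i < n) M (x i) (y i).

End FiniteDistributions.

Definition uniform_dist (K : realType) (T : finType) (x : T) : K :=
  #|T|%:R^-1.

Section Graphs.
Variables (K : realType) (V : finType).

Definition is_simple_graph (e : rel V) : Prop := symmetric e /\ irreflexive e.

Definition neighbours (e : rel V) (a : V) : {set V} := [set b | e a b].

Definition is_regular (e : rel V) (k : nat) : Prop :=
  forall a : V, #|neighbours e a| = k.

(* Only used for disjoint A and B, where each edge between A and B is counted
   by exactly one ordered pair. *)
Definition edges_between (e : rel V) (A B : {set V}) : {set V * V} :=
  [set p | [&& p.1 \in A, p.2 \in B & e p.1 p.2]].

Definition vol (S : {set V}) : K := #|S|%:R / #|V|%:R.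

Definition expansion (e : rel V) (k : nat) (S : {set V}) : K :=
  #|edges_between e S (~: S)|%:R / (k%:R * #|S|%:R).

Definition graph_step (e : rel V) (a b : V) : K :=
  if e a b then #|neighbours e a|%:R^-1 else 0.

Definition noisy_step (e : rel V) (eta : K) (a b : V) : K :=
  (1 - eta) * graph_step e a b + eta * uniform_dist K b.

End Graphs.

Inductive VH : predArgType := Hs | Ht | Ht' | Hs'.

Definition VH_code (h : VH) : bool * bool :=
  match h with
  | Hs => (true, true) | Ht => (true, false)
  | Ht' => (false, false) | Hs' => (false, true)
  end.

Definition VH_decode (c : bool * bool) : VH :=
  match c with
  | (true, true) => Hs | (true, false) => Ht
  | (false, false) => Ht' | (false, true) => Hs'
  end.

Lemma VH_codeK : cancel VH_code VH_decode.
Proof. by case. Qed.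

HB.instance Definition _ := Finite.copy VH (can_type VH_codeK).

(* [H_step eps x y] is p(y|x). *)
Definition H_step (K : realType) (eps : K) (x y : VH) : K :=
  match x, y with
  | Hs, Hs | Hs', Hs' => 1 - eps / (1 - 2 * eps)
  | Hs, Ht | Hs', Ht' => eps / (1 - 2 * eps)
  | Ht, Hs | Ht', Hs' | Ht, Ht' | Ht', Ht => 1 / 2
  | _, _ => 0
  end.

Definition H_stat (K : realType) (eps : K) (x : VH) : K :=
  match x with
  | Hs | Hs' => 1 / 2 - eps
  | Ht | Ht' => eps
  end.

Definition in_st (h : VH) : bool := (h == Hs) || (h == Ht).

Definition st_state : Type := {h : VH | in_st h}.
HB.instance Definition _ := Finite.on st_state.

Section Unfolded.
Variables (K : realType) (V : finType) (R : nat).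

Definition unfolded : Type := {ffun 'I_R -> V * VH}.
HB.instance Definition _ := Finite.on unfolded.

Definition vertex_part (X : unfolded) : {ffun 'I_R -> V} := [ffun i => (X i).1].
Definition state_part (X : unfolded) : {ffun 'I_R -> VH} := [ffun i => (X i).2].

Definition unfolded_mu (eps : K) : unfolded -> K :=
  tensor_dist (fun p : V * VH => uniform_dist K p.1 * H_stat eps p.2).

(* The joint law of ((B,x),(C_1,y_1),...,(C_d,y_d)), the auxiliary vector A
   being summed out; a (d+1)-tuple is split into its first entry and the rest. *)
Definition unfolded_P (e : rel V) (eps eta : K) (d : nat)
    (Z : unfolded * {ffun 'I_d -> unfolded}) : K :=
  (\sum_(A : {ffun 'I_R -> V})
      uniform_dist K A
      * tensor_kernel (noisy_step e eta) A (vertex_part Z.1)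
      * \prod_(j < d) tensor_kernel (noisy_step e eta) A (vertex_part (Z.2 j)))
  * (tensor_dist (H_stat eps) (state_part Z.1)
     * \prod_(j < d) tensor_kernel (H_step eps)
                       (state_part Z.1) (state_part (Z.2 j))).

End Unfolded.

Section Folded.
Variables (K : realType) (V : finType) (R : nat).

(* A multiset of at most R elements of V x {s,t}, as its multiplicity
   function; bounding each multiplicity by R only makes the type finite. *)
Definition folded : Type :=
  {m : {ffun V * st_state -> 'I_R.+1} | (\sum_p (m p : nat) <= R)%N}.
HB.instance Definition _ := Finite.on folded.

Definition multiplicity (X : unfolded V R) (p : V * st_state) : nat :=
  #|[set i | X i == (p.1, val p.2)]|.

Lemma multiplicity_ltn (X : unfolded V R) (p : V * st_state) :
  (multiplicity X p < R.+1)%N.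
Proof. by rewrite ltnS -[leqRHS]card_ord max_card. Qed.

Definition multiplicity_fun (X : unfolded V R) :
    {ffun V * st_state -> 'I_R.+1} :=
  [ffun p => Ordinal (multiplicity_ltn X p)].

Lemma multiplicity_fun_sum (X : unfolded V R) :
  (\sum_p (multiplicity_fun X p : nat) <= R)%N.
Proof.
under eq_bigr do rewrite ffunE /= /multiplicity -sum1dep_card big_mkcond /=.
rewrite exchange_big /= -[leqRHS]card_ord -sum1_card; apply: leq_sum => i _.
rewrite -big_mkcond /= sum1dep_card; apply/card_le1_eqP => -[a x] [b y].
rewrite !inE /= => /eqP -> /eqP [-> /val_inj ->].
by [].
Qed.

Definition fold_proj (X : unfolded V R) : folded :=
  exist _ (multiplicity_fun X) (multiplicity_fun_sum X).

Definition folded_mu (eps : K) : folded -> K :=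
  pushforward fold_proj (@unfolded_mu K V R eps).

Definition fold_proj_tuple (d : nat)
    (Z : unfolded V R * {ffun 'I_d -> unfolded V R}) :
    folded * {ffun 'I_d -> folded} :=
  (fold_proj Z.1, [ffun j => fold_proj (Z.2 j)]).

Definition folded_P (e : rel V) (eps eta : K) (d : nat) :
    folded * {ffun 'I_d -> folded} -> K :=
  pushforward (@fold_proj_tuple d) (@unfolded_P K V R e eps eta d).

End Folded.

Section Functionals.
Variables (K : realType) (T : finType).

Definition bool_dist (a b : bool) : K := `|a%:R - b%:R|.

Definition Var1 (mu : T -> K) (F : T -> bool) : K :=
  expectation (fun p : T * T => mu p.1 * mu p.2)
              (fun p => bool_dist (F p.1) (F p.2)).

Definition val_P (d : nat) (P : T * {ffun 'I_d -> T} -> K) (F : T -> bool) : K :=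
  expectation P
    (fun Z => \big[Num.max/0]_(i < d) bool_dist (F Z.1) (F (Z.2 i))).

End Functionals.

(* Main.v *)
Require Import Defs.
From HB Require Import structures.
From mathcomp Require Import all_boot all_order all_algebra.
From mathcomp Require Import reals ring lra.

Set Implicit Arguments.
Unset Strict Implicit.
Unset Printing Implicit Defensive.

Import Order.TTheory GRing.Theory Num.Theory.
Local Open Scope ring_scope.

(** Take [F' = 1] on the multisets containing an element of [S * {s,t}].
    Each of the [R] coordinates lies in that set with probability
    [delta / 2 = 1 / (2 R)], so [E F' = 1 - (1 - 1/(2R))^R] lies between [1/3]
    and [1/2], which bounds the variance.  For the value, use a union bound over
    the coordinates: a disagreement at coordinate [i] forces either that [S]
    separates [a_i] from [b_i] or from some [c_(j,i)], or that [b_i] is in [S]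
    and [x_i] is [t] or [t'], the only states from which [H] crosses between
    [{s,t}] and [{s',t'}].  The first event has probability at most
    [2 (d+1) delta (eta + gamma)], the second [2 eps delta], and
    [R delta = 1]. *)

(** * Finite expectations: product laws, the variance of an indicator, and Bernoulli-type bounds *)

Section FiniteSums.
Variable K : realType.

Lemma expectation_pushforward (T U : finType) (f : T -> U) (P : T -> K)
    (g : U -> K) :
  expectation (pushforward f P) g = expectation P (g \o f).
Proof.
rewrite /expectation /pushforward [RHS](partition_big f predT) //=.
apply: eq_bigr => y _; rewrite mulr_suml.
by apply: eq_bigr => x /eqP <-.
Qed.

(** Absorb [g] into the factor at [i0] and exchange product and sum: every other factor sums to 1.
    The factors may differ with [i], since the kernels used later depend on the starting point
    [A i]. *)
Lemma sum_tensor_marginal (I T : finType) (p : I -> T -> K) (g : T -> K)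
    (i0 : I) :
  (forall i, \sum_x p i x = 1) ->
  \sum_(f : {ffun I -> T}) (\prod_i p i (f i)) * g (f i0) =
  \sum_x p i0 x * g x.
Proof.
move=> p1; pose q i x := p i x * (if i == i0 then g x else 1).
transitivity (\sum_(f : {ffun I -> T}) \prod_i q i (f i)).
  apply: eq_bigr => f _; rewrite big_split /=; congr (_ * _).
  rewrite (bigD1 i0) //= eqxx big1 ?mulr1 // => i /negPf -> //.
rewrite -(bigA_distr_bigA q) (bigD1 i0) //= [X in _ * X]big1 ?mulr1 => [|i /negPf ni].
  by apply: eq_bigr => x _; rewrite /q eqxx.
by rewrite -[RHS](p1 i); apply: eq_bigr => x _; rewrite /q ni mulr1.
Qed.

Lemma sum_tensor (I T : finType) (p : I -> T -> K) :
  (forall i, \sum_x p i x = 1) ->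
  \sum_(f : {ffun I -> T}) \prod_i p i (f i) = 1.
Proof.
by move=> p1; rewrite -(bigA_distr_bigA p) big1.
Qed.

Lemma sum_pairM (T U : finType) (f : T -> K) (g : U -> K) :
  \sum_(p : T * U) f p.1 * g p.2 = (\sum_x f x) * (\sum_y g y).
Proof.
rewrite mulr_suml -(pair_bigA _ (fun x y => f x * g y)) /=.
by apply: eq_bigr => x _; rewrite mulr_sumr.
Qed.

Lemma bool_distE (a b : bool) : bool_dist K a b = (a (+) b)%:R.
Proof.
by case: a; case: b; rewrite /bool_dist /= ?subrr ?subr0 ?sub0r ?normrN
  ?normr0 ?normr1.
Qed.

(** The two values differ in one of two symmetric ways, and by independence each contributes the
    same product. *)
Lemma Var1E (T : finType) (mu : T -> K) (F : T -> bool) :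
  Var1 mu F = 2 * expectation mu (fun x => (F x)%:R)
                * expectation mu (fun x => (~~ F x)%:R).
Proof.
rewrite /Var1 /expectation.
transitivity (\sum_(p : T * T) ((mu p.1 * (F p.1)%:R) * (mu p.2 * (~~ F p.2)%:R)
  + (mu p.1 * (~~ F p.1)%:R) * (mu p.2 * (F p.2)%:R))).
  apply: eq_bigr => -[x y] _ /=; rewrite bool_distE.
  by case: (F x); case: (F y) => /=; ring.
rewrite big_split /=.
rewrite (sum_pairM (fun x => mu x * (F x)%:R) (fun x => mu x * (~~ F x)%:R)).
rewrite (sum_pairM (fun x => mu x * (~~ F x)%:R) (fun x => mu x * (F x)%:R)).
ring.
Qed.

Lemma sum_uniform (T : finType) : (0 < #|T|)%N -> \sum_(x : T) uniform_dist K x = 1.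
Proof.
move=> T0; rewrite /uniform_dist sumr_const -[LHS]mulr_natr mulVf //.
by rewrite pnatr_eq0 -lt0n.
Qed.

Lemma sum_indicator (T : finType) (P : pred T) :
  \sum_(x : T) (P x)%:R = #|P|%:R :> K.
Proof.
rewrite -sum1_card natr_sum [RHS]big_mkcond /=; apply: eq_bigr => x _.
by rewrite unfold_in; case: (P x).
Qed.

(** With [q = 1/(2n)], Bernoulli's inequality gives the lower bound [1 - nq = 1/2] directly. For the
    upper bound it gives [(1 + q)^n >= 3/2], while [(1 - q)^n (1 + q)^n = (1 - q^2)^n <= 1]. *)
Lemma exp_one_minus_half_bounds (n : nat) : (0 < n)%N ->
  1 / 2 <= (1 - (2 * n%:R)^-1) ^+ n :> K /\
  (1 - (2 * n%:R)^-1) ^+ n <= 2 / 3 :> K.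
Proof.
move=> n0; have n0K : (0 : K) < n%:R by rewrite ltr0n.
have n1K : (1 : K) <= n%:R by rewrite ler1n.
set q : K := (2 * n%:R)^-1.
have qn : q * n%:R = 1 / 2 by rewrite /q; field; rewrite gt_eqF.
have q0 : 0 < q by rewrite invr_gt0 mulr_gt0.
have q1 : q <= 1 / 2 by rewrite -qn ler_peMr // ltW.
have bern (x : K) m : -1 <= x -> 1 + x * m%:R <= (1 + x) ^+ m.
  move=> x1; elim: m => [|m IH]; first by rewrite mulr0 addr0 expr0.
  rewrite exprS; apply: le_trans (ler_wpM2l _ IH); last lra.
  have m0 : (0 : K) <= m%:R by [].
  by rewrite -natr1; nra.
split.
  by have := bern (- q) n; rewrite mulNr qn => H; apply: le_trans (H _); lra.
have B : 3 / 2 <= (1 + q) ^+ n.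
  by have := bern q n; rewrite qn => H; apply: le_trans (H _); lra.
have p0 : 0 <= (1 - q) ^+ n by rewrite exprn_ge0 //; lra.
have : (1 - q) ^+ n * (1 + q) ^+ n <= 1.
  by rewrite -exprMn exprn_ile1 //; nra.
nra.
Qed.

End FiniteSums.

(** * One step of the noisy graph walk and its probability of crossing the boundary of [S] *)

Section Graph.
Variables (K : realType) (V : finType) (e : rel V) (k : nat).
Hypotheses (e_simple : is_simple_graph e) (e_reg : is_regular e k).
Hypotheses (k_gt0 : (0 < k)%N) (V_gt0 : (0 < #|V|)%N).
Variables (eta : K).
Hypotheses (eta_ge0 : 0 <= eta) (eta_le1 : eta <= 1).

Let kK : (k%:R : K) != 0.
Proof. by rewrite pnatr_eq0 -lt0n. Qed.
Let VK : (#|V|%:R : K) != 0.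
Proof. by rewrite pnatr_eq0 -lt0n. Qed.

Lemma graph_stepE a b : graph_step K e a b = (e a b)%:R / k%:R.
Proof. by rewrite /graph_step e_reg; case: (e a b); rewrite ?mul1r ?mul0r. Qed.

Lemma graph_step_sum a : \sum_b graph_step K e a b = 1.
Proof.
under eq_bigr do rewrite graph_stepE.
rewrite -mulr_suml sum_indicator.
by have <- := e_reg a; rewrite cardsE divff // -cardsE e_reg.
Qed.

Lemma noisy_step_ge0 a b : 0 <= noisy_step e eta a b.
Proof.
by rewrite addr_ge0 // mulr_ge0 ?subr_ge0 ?invr_ge0 // graph_stepE divr_ge0.
Qed.

Lemma noisy_step_sum a : \sum_b noisy_step e eta a b = 1.
Proof.
rewrite big_split /= -!mulr_sumr graph_step_sum sum_uniform //; ring.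
Qed.

Lemma noisy_stepC a b : noisy_step e eta a b = noisy_step e eta b a.
Proof. by rewrite /noisy_step !graph_stepE (e_simple.1 a b). Qed.

(** On a regular graph the kernel is symmetric, hence doubly stochastic. *)
Lemma noisy_step_stationary b :
  \sum_a uniform_dist K a * noisy_step e eta a b = uniform_dist K b.
Proof.
rewrite -mulr_sumr; under eq_bigr do rewrite noisy_stepC.
by rewrite noisy_step_sum mulr1.
Qed.

Variable S : {set V}.

Definition cut (a b : V) : bool := (a \in S) (+) (b \in S).

(** Each boundary edge can be crossed in both directions, whence the factor 2; [f] in the proof
    keeps only the crossings that leave [S]. *)
Lemma graph_step_cut :
  \sum_a \sum_b graph_step K e a b * (cut a b)%:R =
  2 * #|edges_between e S (~: S)|%:R / k%:R.
Proof.
pose f (a b : V) : K := (e a b)%:R * ((a \in S) && (b \notin S))%:R.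
transitivity (\sum_a \sum_b (f a b + f b a) / k%:R).
  apply: eq_bigr => a _; apply: eq_bigr => b _.
  rewrite graph_stepE /f (e_simple.1 b a) /cut.
  by case: (e a b); case: (a \in S); case: (b \in S) => /=; ring.
transitivity ((\sum_a \sum_b f a b + \sum_a \sum_b f b a) / k%:R).
  rewrite -big_split /= mulr_suml; apply: eq_bigr => a _.
  by rewrite -big_split /= mulr_suml.
rewrite [X in (_ + X) / _]exchange_big /= -mulr2n mulr_natl.
congr (_ *+ 2 / _); rewrite pair_bigA /= -sum1_card natr_sum big_mkcond /=.
rewrite [RHS]big_mkcond /=; apply: eq_bigr => -[a b] _ /=; rewrite inE /f /= inE.
by case: (e a b); case: (a \in S); case: (b \in S) => /=; ring.
Qed.

(** The graph part contributes at most [2 vol(S) Phi(S)]. For the noise part both endpoints are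
    uniform, and separation requires one of them to lie in [S], which costs at most
    [2 eta vol(S)]. *)
Lemma noisy_step_cut (gamma : K) :
  (0 < #|S|)%N -> expansion K e k S <= gamma ->
  \sum_a uniform_dist K a * \sum_b noisy_step e eta a b * (cut a b)%:R
    <= 2 * vol K S * (eta + gamma).
Proof.
move=> S0 exp_le; pose v : K := #|V|%:R^-1.
have v0 : 0 <= v by rewrite invr_ge0.
have S0K : (0 : K) < #|S|%:R by rewrite ltr0n.
have k0K : (0 : K) < k%:R by rewrite ltr0n.
pose f a b : K := v * (graph_step K e a b * (cut a b)%:R).
pose g (a b : V) : K := (eta * v) * (v * ((a \in S)%:R + (b \in S)%:R)).
apply: (@le_trans _ _ (\sum_a \sum_b (f a b + g a b))).
  apply: ler_sum => a _; rewrite mulr_sumr; apply: ler_sum => b _.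
  rewrite /f /g /noisy_step /uniform_dist -/v.
  have gs0 : 0 <= graph_step K e a b by rewrite graph_stepE divr_ge0.
  have vv : 0 <= eta * v * v by rewrite !mulr_ge0.
  (* This is the term given away when the factor [1 - eta] is replaced by 1. *)
  have vg : 0 <= eta * (v * graph_step K e a b) by rewrite !mulr_ge0.
  by rewrite /cut; case: (a \in S); case: (b \in S) => /=; nra.
have -> : \sum_a \sum_b (f a b + g a b) =
    v * (\sum_a \sum_b graph_step K e a b * (cut a b)%:R)
    + eta * v * (v * (\sum_(a : V) \sum_(b : V) (a \in S)%:R
                      + \sum_(a : V) \sum_(b : V) (b \in S)%:R)).
  rewrite -big_split /= !mulr_sumr -big_split /=; apply: eq_bigr => a _.
  by rewrite -big_split /= !mulr_sumr -big_split.
rewrite [X in _ * (_ * (X + _))]exchange_big /= graph_step_cut.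
have -> : \sum_(a : V) (a \in S)%:R = #|S|%:R :> K by rewrite sum_indicator.
rewrite sumr_const -[#|S|%:R *+ _]mulr_natr.
move: exp_le; rewrite /expansion /vol ler_pdivrMr ?mulr_gt0 // => exp_le.
set s : K := #|S|%:R in S0K exp_le *; set E : K := #|edges_between _ _ _|%:R in exp_le *.
have vV : v * #|V|%:R = 1 by rewrite mulVf.
have -> : eta * v * (v * (s * #|V|%:R + s * #|V|%:R)) = 2 * (s * v) * eta.
  by rewrite -[RHS]mulr1 -vV; ring.
rewrite -/v mulrDr addrC lerD2l.
have -> : v * (2 * E / k%:R) = 2 * v * (E / k%:R) by ring.
have -> : 2 * (s * v) * gamma = 2 * v * (s * gamma) by ring.
rewrite ler_wpM2l ?mulr_ge0 // ler_pdivrMr //.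
by have -> : s * gamma * k%:R = gamma * (k%:R * s) by ring.
Qed.

End Graph.

(** * The four-state chain [H] *)

Section Chain.
Variables (K : realType) (eps : K).
Hypotheses (eps_ge0 : 0 <= eps) (eps_le : eps <= 1 / 3).

Lemma sum_VH (f : VH -> K) : \sum_h f h = f Hs + f Ht + f Ht' + f Hs'.
Proof.
rewrite (reindex VH_decode) /=; last first.
  by exists VH_code => [[[] []]|[]].
under eq_bigr do rewrite [X in VH_decode X]surjective_pairing.
rewrite -(pair_bigA _ (fun a b => f (VH_decode (a, b)))) /=.
by rewrite !big_bool /=; ring.
Qed.

Lemma H_step_ge0 h h' : 0 <= H_step eps h h'.
Proof.
have [e0 e1] := (eps_ge0, eps_le).
have p0 : 0 < 1 - 2 * eps by lra.
have q1 : eps / (1 - 2 * eps) <= 1 by rewrite ler_pdivrMr //; lra.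
have q0 : 0 <= eps / (1 - 2 * eps) by rewrite divr_ge0 // ltW.
by case: h; case: h' => //=; lra.
Qed.

Lemma H_stat_ge0 h : 0 <= H_stat eps h.
Proof. by have [e0 e1] := (eps_ge0, eps_le); case: h => /=; lra. Qed.

Lemma H_step_sum h : \sum_h' H_step eps h h' = 1.
Proof. by rewrite sum_VH; case: h => /=; lra. Qed.

Lemma H_stat_sum : \sum_h H_stat eps h = 1.
Proof. by rewrite sum_VH /=; lra. Qed.

Definition in_tt' (h : VH) : bool := (h == Ht) || (h == Ht').

Lemma H_step_cross h h' :
  in_st h != in_st h' -> ~~ in_tt' h -> H_step eps h h' = 0.
Proof. by case: h; case: h'. Qed.

Lemma H_stat_tt' : \sum_h H_stat eps h * (in_tt' h)%:R = 2 * eps.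
Proof. by rewrite sum_VH /=; ring. Qed.

Lemma H_stat_st : \sum_h H_stat eps h * (in_st h)%:R = 1 / 2.
Proof. by rewrite sum_VH /=; lra. Qed.

End Chain.

(** * The cut function on multisets and its pullback to unfolded points *)

Section Folding.
Variables (V : finType) (R : nat) (S : {set V}).

Definition active (p : V * VH) : bool := (p.1 \in S) && in_st p.2.

(** This is the witness [F']. It reads only the multiset, so it lives on the folded space;
    [hits_fold_proj] turns it into an event about coordinates. *)
Definition hits (m : folded V R) : bool :=
  [exists p : V * st_state, (p.1 \in S) && (0 < val m p)%N].

Lemma hits_fold_proj (X : unfolded V R) :
  hits (fold_proj X) = [exists i, active (X i)].
Proof.
apply/existsP/existsP => [[[a h] /= /andP[aS]]|[i /andP[iS ih]]].
  rewrite ffunE /= /multiplicity => /card_gt0P[i]; rewrite inE => /eqP Xi.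
  by exists i; rewrite Xi /active aS /= (valP h).
exists ((X i).1, exist (fun h => in_st h) _ ih); rewrite iS /= ffunE /=.
by apply/card_gt0P; exists i; rewrite inE /= -surjective_pairing.
Qed.

Lemma hits_neq (X Y : unfolded V R) :
  hits (fold_proj X) != hits (fold_proj Y) ->
  exists i, active (X i) != active (Y i).
Proof.
rewrite !hits_fold_proj => neq; apply/existsP; apply: contraR neq.
rewrite negb_exists => /forallP eqXY.
by apply/eqP; apply: eq_existsb => i; apply/eqP; have := eqXY i; rewrite negbK.
Qed.

End Folding.

(** * The law of the unfolded instance, its marginals, and the value and mean of [hits] *)

Section Law.
Variables (K : realType) (V : finType) (e : rel V) (k : nat).
Hypotheses (e_simple : is_simple_graph e) (e_reg : is_regular e k).
Hypotheses (k_gt0 : (0 < k)%N) (V_gt0 : (0 < #|V|)%N).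
Variables (eps eta : K) (d R : nat).
Hypotheses (eta_ge0 : 0 <= eta) (eta_le1 : eta <= 1).
Hypotheses (eps_ge0 : 0 <= eps) (eps_le : eps <= 1 / 3).

Let u : V -> K := @uniform_dist K V.
Let q (a : V) (p : V * VH) : K := noisy_step e eta a p.1 * H_stat eps p.2.
Let r (a : V) (h : VH) (p : V * VH) : K :=
  noisy_step e eta a p.1 * H_step eps h p.2.

(** The auxiliary vector [A] is kept explicit, because the union bound compares the vertices of [X]
    and [Y j] with [A i]. Vertex and state factors are grouped by coordinate so that marginals can
    be taken coordinatewise. *)
Definition joint_law (A : {ffun 'I_R -> V}) (X : unfolded V R)
    (Y : {ffun 'I_d -> unfolded V R}) : K :=
  (\prod_i u (A i)) * (\prod_i q (A i) (X i))
  * \prod_j \prod_i r (A i) (X i).2 (Y j i).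

Lemma unfolded_P_joint X Y :
  unfolded_P e eps eta (X, Y) = \sum_A joint_law A X Y.
Proof.
rewrite /unfolded_P mulr_suml; apply: eq_bigr => A _ /=.
have -> : uniform_dist K A = \prod_i u (A i).
  rewrite /u /uniform_dist card_ffun card_ord natrX -exprVn.
  by rewrite prodr_const card_ord.
rewrite /joint_law /tensor_kernel /tensor_dist.
have -> : \prod_i q (A i) (X i) =
    (\prod_i noisy_step e eta (A i) (vertex_part X i))
    * (\prod_i H_stat eps (state_part X i)).
  by rewrite -big_split; apply: eq_bigr => i _; rewrite !ffunE.
have -> : \prod_j \prod_i r (A i) (X i).2 (Y j i) =
    (\prod_j \prod_i noisy_step e eta (A i) (vertex_part (Y j) i))
    * \prod_j \prod_i H_step eps (state_part X i) (state_part (Y j) i).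
  rewrite -big_split; apply: eq_bigr => j _; rewrite -big_split.
  by apply: eq_bigr => i _; rewrite !ffunE.
ring.
Qed.

Lemma joint_law_ge0 A X Y : 0 <= joint_law A X Y.
Proof.
have n0 := noisy_step_ge0 e_reg eta_ge0 eta_le1.
rewrite !mulr_ge0 ?prodr_ge0 // => [i _|i _|j _].
- by rewrite invr_ge0.
- by rewrite mulr_ge0 ?n0 ?H_stat_ge0.
- by rewrite prodr_ge0 // => i _; rewrite mulr_ge0 ?n0 ?H_step_ge0.
Qed.

Let u1 : \sum_a u a = 1. Proof. exact: sum_uniform. Qed.

Let q1 a : \sum_p q a p = 1.
Proof.
by rewrite sum_pairM (noisy_step_sum e_reg) // H_stat_sum ?mulr1.
Qed.

Let r1 a h : \sum_p r a h p = 1.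
Proof.
by rewrite sum_pairM (noisy_step_sum e_reg) // H_step_sum ?mulr1.
Qed.

Lemma joint_law_marginal_X (g : V -> V * VH -> K) (i : 'I_R) :
  \sum_A \sum_X \sum_Y joint_law A X Y * g (A i) (X i) =
  \sum_a u a * \sum_p noisy_step e eta a p.1 * H_stat eps p.2 * g a p.
Proof.
rewrite -(@sum_tensor_marginal _ _ _ (fun=> u)
  (fun a => \sum_p q a p * g a p) i) //.
apply: eq_bigr => A _.
rewrite -(@sum_tensor_marginal _ _ _ (fun i => q (A i)) (g (A i)) i) //.
rewrite mulr_sumr; apply: eq_bigr => X _; rewrite -mulr_suml -mulr_sumr.
(* Given [A] and [X], the [d] copies are independent and each has total mass 1. *)
rewrite (sum_tensor (p := fun _ (Z : unfolded V R) =>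
  \prod_i r (A i) (X i).2 (Z i))) ?mulr1 ?mulrA // => j.
exact: (sum_tensor (p := fun i => r (A i) (X i).2)).
Qed.

Lemma joint_law_marginal_Y (g : V -> V -> K) (i : 'I_R) (j : 'I_d) :
  \sum_A \sum_X \sum_Y joint_law A X Y * g (A i) (Y j i).1 =
  \sum_a u a * \sum_b noisy_step e eta a b * g a b.
Proof.
rewrite -(@sum_tensor_marginal _ _ _ (fun=> u)
  (fun a => \sum_b noisy_step e eta a b * g a b) i) //.
apply: eq_bigr => A _.
(* Once [A] is fixed, the vertices of [Y j] do not depend on [X], so the inner expectation is a
   constant and the mass of [X] sums to 1. *)
transitivity (\sum_(X : unfolded V R) (\prod_i u (A i)) * (\prod_i q (A i) (X i))
    * \sum_b noisy_step e eta (A i) b * g (A i) b); last first.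
  rewrite -mulr_suml -mulr_sumr; congr (_ * _).
  by rewrite (sum_tensor (p := fun i => q (A i))) ?mulr1.
apply: eq_bigr => X _.
transitivity ((\prod_i u (A i)) * (\prod_i q (A i) (X i)) *
    \sum_(Y : {ffun 'I_d -> unfolded V R})
      (\prod_j \prod_i r (A i) (X i).2 (Y j i)) * g (A i) (Y j i).1).
  by rewrite mulr_sumr; apply: eq_bigr => Y _; rewrite [RHS]mulrA.
congr (_ * _).
have kap1 (j' : 'I_d) :
    \sum_(Z : unfolded V R) \prod_i r (A i) (X i).2 (Z i) = 1.
  exact: (sum_tensor (p := fun i => r (A i) (X i).2)).
(* The marginal is taken twice: first to copy [j], then to coordinate [i] inside that copy. *)
rewrite (sum_tensor_marginal (fun Z : unfolded V R => g (A i) (Z i).1) j kap1).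
rewrite (sum_tensor_marginal (p := fun i => r (A i) (X i).2)
  (fun p => g (A i) p.1) i) //.
rewrite -[RHS]mulr1 -(H_step_sum eps (X i).2) -sum_pairM.
by apply: eq_bigr => p _; rewrite /r; ring.
Qed.

Variable S : {set V}.

Let max_disagreement (X : unfolded V R) (Y : {ffun 'I_d -> unfolded V R}) : K :=
  \big[Num.max/0]_(j < d)
    bool_dist K (hits S (fold_proj X)) (hits S (fold_proj (Y j))).

(** If some copy disagrees with [X], then some coordinate does, and its summand is at least 1. The
    weight stays on both sides because forbidden moves of [H] are excluded only where it is
    nonzero. *)
Lemma joint_law_disagreement A X Y :
  joint_law A X Y * max_disagreement X Y <=
  joint_law A X Y *
    \sum_i ((cut S (A i) (X i).1)%:R + \sum_j (cut S (A i) (Y j i).1)%:R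
            + (((X i).1 \in S) && in_tt' (X i).2)%:R).
Proof.
have [->|w_neq0] := eqVneq (joint_law A X Y) 0; first by rewrite !mul0r.
apply: ler_wpM2l; first exact: joint_law_ge0.
set t := (F in \sum_i F i).
have t_ge0 i : 0 <= t i by rewrite !addr_ge0 ?sumr_ge0.
(* The default value 0 of the maximum also has to lie below the bound. *)
apply: bigmax_le => [|j _]; first by rewrite sumr_ge0.
rewrite bool_distE; case: (boolP (_ (+) _)) => [neq|_]; last by rewrite sumr_ge0.
have /hits_neq[i XYi] : hits S (fold_proj X) != hits S (fold_proj (Y j)).
  by rewrite -negb_add negbK.
rewrite (bigD1 i) //= -[leLHS]addr0 lerD ?sumr_ge0 //.
have H_neq0 : H_step eps (X i).2 (Y j i).2 != 0.
  move: w_neq0; rewrite mulf_eq0 negb_or => /andP[_ /prodf_neq0/(_ j isT)].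
  by move=> /prodf_neq0/(_ i isT); rewrite mulf_eq0 negb_or => /andP[].
rewrite /t (bigD1 j) //=.
have s_ge0 : 0 <= \sum_(j' < d | j' != j) (cut S (A i) (Y j' i).1)%:R :> K.
  by rewrite sumr_ge0.
move: (\sum_(_ < d | _) _) s_ge0 => s s_ge0.
have tt_ge0 : 0 <= (in_tt' (X i).2)%:R :> K by [].
move: XYi; rewrite /active /cut.
(* If neither [X i] nor [Y j i] has its vertex in [S], both are inactive, against the choice of [i].
   In the other cases a cut indicator equals 1, except when all three vertices lie in [S]; then the
   states differ in [in_st], so the move of [H] must start in [t] or [t']. *)
case: (A i \in S); case: ((X i).1 \in S); case: ((Y j i).1 \in S) => //= st_neq;
  try by lra.
case: (boolP (in_tt' (X i).2)) => tt /=; first by lra.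
by move: H_neq0; rewrite H_step_cross ?eqxx.
Qed.

Lemma joint_law_sum (I : finType)
    (g : I -> {ffun 'I_R -> V} -> unfolded V R ->
         {ffun 'I_d -> unfolded V R} -> K) :
  \sum_A \sum_X \sum_Y joint_law A X Y * \sum_i g i A X Y =
  \sum_i \sum_A \sum_X \sum_Y joint_law A X Y * g i A X Y.
Proof.
rewrite [RHS]exchange_big; apply: eq_bigr => A _.
rewrite [RHS]exchange_big; apply: eq_bigr => X _.
by rewrite [RHS]exchange_big; apply: eq_bigr => Y _; rewrite mulr_sumr.
Qed.

Lemma joint_law_add (f g : {ffun 'I_R -> V} -> unfolded V R ->
    {ffun 'I_d -> unfolded V R} -> K) :
  \sum_A \sum_X \sum_Y joint_law A X Y * (f A X Y + g A X Y) =
  \sum_A \sum_X \sum_Y joint_law A X Y * f A X Y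
  + \sum_A \sum_X \sum_Y joint_law A X Y * g A X Y.
Proof.
do 3![rewrite -big_split; apply: eq_bigr => ? _].
exact: mulrDr.
Qed.

Lemma uniform_vol : \sum_a u a * (a \in S)%:R = vol K S.
Proof. by rewrite -mulr_sumr sum_indicator mulrC. Qed.

(** Vertex and state of [X i] are independent: by stationarity the vertex is uniform, and [{t, t'}]
    has mass [2 eps]. *)
Lemma joint_law_boundary i :
  \sum_A \sum_X \sum_Y joint_law A X Y
    * (((X i).1 \in S) && in_tt' (X i).2)%:R = 2 * eps * vol K S.
Proof.
rewrite (joint_law_marginal_X (fun _ p => ((p.1 \in S) && in_tt' p.2)%:R)).
transitivity (\sum_a \sum_b
    u a * noisy_step e eta a b * ((b \in S)%:R * (2 * eps))).
  apply: eq_bigr => a _; rewrite -H_stat_tt'.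
  transitivity (u a * ((\sum_b noisy_step e eta a b * (b \in S)%:R)
    * \sum_h H_stat eps h * (in_tt' h)%:R)).
    rewrite -sum_pairM; congr (_ * _); apply: eq_bigr => -[b h] _ /=.
    by rewrite -mulnb natrM; ring.
  by rewrite mulr_suml mulr_sumr; apply: eq_bigr => b _; ring.
rewrite exchange_big /= -uniform_vol mulr_sumr; apply: eq_bigr => b _.
rewrite -mulr_suml (noisy_step_stationary e_simple e_reg) // /u; ring.
Qed.

Lemma joint_law_cut_X i :
  \sum_A \sum_X \sum_Y joint_law A X Y * (cut S (A i) (X i).1)%:R =
  \sum_a u a * \sum_b noisy_step e eta a b * (cut S a b)%:R.
Proof.
rewrite (joint_law_marginal_X (fun a p => (cut S a p.1)%:R)).
apply: eq_bigr => a _; congr (_ * _).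
rewrite -[RHS]mulr1 -(H_stat_sum eps) -sum_pairM.
by apply: eq_bigr => p _; ring.
Qed.

(** Each coordinate pays one boundary term and [d + 1] cut terms: one for [X] and one for each
    [Y j]. *)
Lemma val_hits_le (gamma : K) :
  (0 < #|S|)%N -> expansion K e k S <= gamma ->
  val_P (folded_P e eps eta (d := d)) (@hits V R S) <=
  R%:R * vol K S * (2 * eps + 2 * d.+1%:R * (eta + gamma)).
Proof.
move=> S0 expS; rewrite /val_P expectation_pushforward /expectation.
set val := (X in X <= _).
have -> : val = \sum_A \sum_X \sum_Y joint_law A X Y * max_disagreement X Y.
  rewrite /val.
  transitivity (\sum_X \sum_Y \sum_A joint_law A X Y * max_disagreement X Y).
    rewrite pair_bigA /=; apply: eq_bigr => -[X Y] _ /=.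
    rewrite unfolded_P_joint mulr_suml; apply: eq_bigr => A _; congr (_ * _).
    by apply: eq_bigr => j _; rewrite ffunE.
  rewrite [RHS]exchange_big; apply: eq_bigr => X _.
  exact: exchange_big.
apply: (@le_trans _ _ (\sum_A \sum_X \sum_Y joint_law A X Y *
    \sum_i ((cut S (A i) (X i).1)%:R + \sum_j (cut S (A i) (Y j i).1)%:R
            + (((X i).1 \in S) && in_tt' (X i).2)%:R))).
  by do 3![apply: ler_sum => ? _]; exact: joint_law_disagreement.
have cut_le := noisy_step_cut e_simple e_reg k_gt0 V_gt0 eta_ge0 S0 expS.
rewrite joint_law_sum.
apply: (@le_trans _ _ (\sum_(i < R)
    vol K S * (2 * eps + 2 * d.+1%:R * (eta + gamma)))); last first.
  by rewrite sumr_const card_ord -[leLHS]mulr_natl mulrA.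
apply: ler_sum => i _.
rewrite (joint_law_add (fun A X Y => (cut S (A i) (X i).1)%:R
  + \sum_j (cut S (A i) (Y j i).1)%:R)) joint_law_boundary.
rewrite (joint_law_add (fun A X Y => (cut S (A i) (X i).1)%:R)) joint_law_cut_X.
rewrite (joint_law_sum (fun j A X Y => (cut S (A i) (Y j i).1)%:R)).
rewrite (eq_bigr _ (fun j _ =>
  joint_law_marginal_Y (fun a b => (cut S a b)%:R) i j)).
rewrite sumr_const card_ord -[X in _ + X + _]mulr_natl -natr1.
have d0 : (0 : K) <= d%:R by [].
have := ler_wpM2l d0 cut_le; move: cut_le; rewrite -/u; lra.
Qed.

Lemma sum_inactive :
  \sum_(p : V * VH) u p.1 * H_stat eps p.2 * (~~ active S p)%:R =
  1 - vol K S / 2.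
Proof.
transitivity (\sum_(p : V * VH) (u p.1 * H_stat eps p.2
  - (u p.1 * (p.1 \in S)%:R) * (H_stat eps p.2 * (in_st p.2)%:R))).
  apply: eq_bigr => -[a h] _; rewrite /active /=.
  by case: (a \in S); case: (in_st h) => /=; ring.
rewrite sumrB sum_pairM (sum_pairM (fun a => u a * (a \in S)%:R)
  (fun h => H_stat eps h * (in_st h)%:R)).
by rewrite uniform_vol u1 H_stat_sum H_stat_st mulr1 div1r.
Qed.

(** The [R] coordinates are independent, and the event says that all of them are inactive. *)
Lemma expectation_not_hits :
  expectation (unfolded_mu (V := V) (R := R) eps)
    (fun X => (~~ hits S (fold_proj X))%:R) = (1 - vol K S / 2) ^+ R.
Proof.
rewrite -sum_inactive -[X in _ ^+ X]card_ord -prodr_const.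
rewrite (bigA_distr_bigA (fun _ (p : V * VH) =>
  u p.1 * H_stat eps p.2 * (~~ active S p)%:R)).
apply: eq_bigr => X _; rewrite big_split /=; congr (_ * _).
rewrite hits_fold_proj; case: existsP => [[i Xi]|none].
  by rewrite (bigD1 i) //= Xi mul0r.
rewrite big1 // => i _; case: (boolP (active S (X i))) => // Xi.
by case: none; exists i.
Qed.

Lemma expectation_hits :
  expectation (unfolded_mu (V := V) (R := R) eps)
    (fun X => (hits S (fold_proj X))%:R) = 1 - (1 - vol K S / 2) ^+ R.
Proof.
rewrite -expectation_not_hits /expectation.
have mu1 : \sum_X unfolded_mu (V := V) (R := R) eps X = 1.
  apply: (sum_tensor (p := fun=> fun p : V * VH => u p.1 * H_stat eps p.2)) => i.
  by rewrite sum_pairM u1 H_stat_sum mulr1.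
rewrite -[X in X - _]mu1 -sumrB; apply: eq_bigr => X _.
by case: (hits _ _) => /=; ring.
Qed.

End Law.

(** * Choice of the constant and assembly of the bounds *)

Theorem theorem6p1 (K : realType) :
  exists2 C : K, 0 < C &
  forall (V : finType) (e : rel V) (k : nat)
         (eps delta eta gamma : K) (d R : nat),
    is_simple_graph e -> is_regular e k -> (0 < k)%N ->
    0 < eps -> eps <= 1 / 3 ->
    (1 <= d)%N ->
    0 < delta -> (0 < R)%N -> R%:R = 1 / delta ->
    eta = eps / (100 * d%:R) ->
    0 < gamma -> gamma < eps / (100 * d%:R) ->
    (exists S : {set V}, vol K S = delta /\ expansion K e k S <= gamma) ->
    exists F : folded V R -> bool,
      [/\ 1 / 10 <= Var1 (folded_mu eps) F,
          val_P (folded_P e eps eta (d := d)) F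
            <= 2 * eps + C * (d%:R * (eta + gamma))
        & 2 * eps + C * (d%:R * (eta + gamma)) <= 4 * eps].
Proof.
(* The constant comes from [2 (d + 1) <= 4 d] for [d >= 1]. *)
exists 4 => // V e k eps delta eta gamma d R e_simple e_reg k_gt0 eps_gt0 eps_le.
move=> d_ge1 delta_gt0 R_gt0 R_delta etaE gamma_gt0 gamma_lt [S [volS expS]].
have d1 : (1 : K) <= d%:R by rewrite ler1n.
have d_eta : d%:R * eta = eps / 100 by rewrite etaE; field; rewrite gt_eqF; lra.
have d_gamma : d%:R * gamma <= eps / 100.
  rewrite -d_eta ler_wpM2l ?ler0n // etaE ltW //.
have eta_gt0 : 0 < eta by rewrite etaE divr_gt0 // mulr_gt0 //; lra.
have eta_le1 : eta <= 1 by nra.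
(* An empty [S] would have volume 0, against [delta > 0]. *)
have [S_gt0 V_gt0] : (0 < #|S|)%N /\ (0 < #|V|)%N.
  move: delta_gt0; rewrite -volS /vol; case: (posnP #|S|) => [->|S_gt0].
    by rewrite mul0r ltxx.
  by move=> _; split => //; apply: leq_trans S_gt0 (max_card _).
have R_vol : R%:R * vol K S = 1.
  by rewrite volS R_delta; field; rewrite gt_eqF.
exists (@hits V R S); split.
- rewrite Var1E /folded_mu !expectation_pushforward /comp.
  rewrite expectation_hits // expectation_not_hits //.
  have -> : vol K S / 2 = (2 * R%:R)^-1.
    by rewrite volS R_delta; field; rewrite gt_eqF.
  (* With [p] the miss probability, [1/2 <= p <= 2/3] gives [2 p (1 - p) >= 4/9]. *)
  have [] := exp_one_minus_half_bounds K R_gt0; nra.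
- have eps_ge0 := ltW eps_gt0; have eta_ge0 := ltW eta_gt0.
  have := val_hits_le e_simple e_reg k_gt0 V_gt0 d R eta_ge0 eta_le1
    eps_ge0 eps_le S_gt0 expS.
  move/le_trans; apply.
  rewrite R_vol mul1r -natr1; nra.
(* Both [d eta] and [d gamma] are at most [eps / 100], so the error is at most [8 eps / 100]. *)
- rewrite mulrDr; nra.
Qed.
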